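(* Let $s \ge 2$ and let $\Sigma = \{{\tt 0}, {\tt 1}, \ldots, s-1\}$, whose letters are identified with the base-$s$ digits. Let $m, n$ be integers with $0 < m < n < 2m$ and $\gcd(m,n) = 1$, and let $S = (\Sigma^m \cup \Sigma^n) \setminus T(m,n)$. Then $S^*$ is co-finite, and the longest words in $\Sigma^* \setminus S^*$ have length exactly $g(m,l) = ml - m - l$, where $l = m s^{n-m} + n - m$.
   Context: For integers $N \ge 0$, $k \ge 2$, $L \ge 1$ with $N < k^L$, $r(N, k, L)$ denotes the word of length $L$ over the digits $\{0,\ldots,k-1\}$ representing $N$ in base $k$, padded with leading zeros. For integers $0 < m < n$, $T(m,n) = \{ r(i, s, n-m)\,{\tt 0}^{2m-n}\, r(i+1, s, n-m) : 0 \le i \le s^{n-m} - 2 \}$. $\Sigma^j$ is the set of words of length $j$ over $\Sigma$; a language $L \subseteq \Sigma^*$ is co-finite if $\Sigma^* \setminus L$ is finite. *)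

(* Defs.v *)
From mathcomp Require Import all_boot.
From mathcomp Require Import boolp classical_sets cardinality.

Set Implicit Arguments.
Unset Strict Implicit.
Unset Printing Implicit Defensive.

Local Open Scope classical_set_scope.

(* r(N, k, L), most significant digit first; for N >= k ^ L only the L low
   order digits are kept, a case that does not arise below. *)
Fixpoint base_rep (N k L : nat) : seq nat :=
  if L is L'.+1 then rcons (base_rep (N %/ k) k L') (N %% k) else [::].

Definition words_of_length (A : Type) (j : nat) : set (seq A) :=
  [set w | size w = j].

Definition kleene_star (A : eqType) (L : set (seq A)) : set (seq A) :=
  [set w | exists2 us : seq (seq A),
     (forall u, u \in us -> L u) & w = flatten us].

Definition cofinite_language (A : Type) (L : set (seq A)) : Prop :=
  finite_set (~` L).

(* Letters are the ordinals below s, compared with digits through val. For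
   0 < m < n < 2m and s >= 2 no subtraction is truncated. *)
Definition T (s m n : nat) : set (seq 'I_s) :=
  [set w | exists2 i : nat, i <= s ^ (n - m) - 2 &
     map val w = base_rep i s (n - m) ++ nseq (2 * m - n) 0
                   ++ base_rep i.+1 s (n - m)].

Definition S_lang (s m n : nat) : set (seq 'I_s) :=
  (words_of_length m `|` words_of_length n) `\` T m n.

(* Frobenius number of a, b; for a, b >= 2 the subtractions are not truncated. *)
Definition g (a b : nat) : nat := a * b - a - b.

(* Main.v *)
(** Put [q = s ^ (n - m) - 1] and [l = q m + n].

    Upper bound. If a word of length [l] is not in [S^*], its factor of length
    [n] at position [j m] is in [T] for every [j <= q]; consecutive such factors
    overlap in [n - m] letters, so the integers they encode increase by one at
    each step, which is impossible for [q + 1] integers below [q]. Hence [S^*]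
    contains every word of length [l] or [m], and thus every word whose length
    is a combination of [m] and [l].

    Lower bound. Consider a word of period [l] whose period lists the base-[s]
    representations of [0, ..., q] separated by zeros. Its factors of length [n]
    at positions [p m + j l] with [p < q] are in [T], so in any factorization
    over [S] every prefix has a length of the form [i m + j l]: a block of
    length [n] can only be used when [i >= q], and it then replaces [i] by
    [i - q] and [j] by [j + 1]. The Frobenius number of [m] and [l] is not of
    that form. *)
Require Import Defs.
From mathcomp Require Import all_boot.
From mathcomp Require Import boolp classical_sets cardinality zify.

Set Implicit Arguments.
Unset Strict Implicit.
Unset Printing Implicit Defensive.

Local Open Scope classical_set_scope.

Definition nat_span (a b : nat) : set nat :=
  [set N | exists i j, N = i * a + j * b].

Lemma gt_Frobenius_nat_span a b N :
  0 < a -> coprime a b -> g a b < N -> nat_span a b N.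
Proof.
move=> a_gt0 co_ab gN; pose j := (chinese a b N 0 %/ b) %% a.
have j_lt : j < a by rewrite ltn_mod.
have jb_mod : j * b = N %[mod a].
  rewrite /j modnMml divnK ?chinese_modl //.
  by rewrite /dvdn chinese_modr // mod0n.
have [jb_le|N_lt] := leqP (j * b) N.
  exists ((N - j * b) %/ a), j.
  by rewrite divnK ?subnK // -eqn_mod_dvd // jb_mod.
have : a %| j * b - N by rewrite -eqn_mod_dvd ?jb_mod // ltnW.
move/dvdn_leq; rewrite subn_gt0 => /(_ N_lt).
by rewrite /g in gN; nia.
Qed.

Lemma Frobenius_notin_nat_span a b :
  1 < a -> 1 < b -> coprime a b -> ~ nat_span a b (g a b).
Proof.
move=> a_gt1 b_gt1 co_ab [i [j eg]].
have eab : (a - 1) * b = i.+1 * a + j * b by rewrite /g in eg; nia.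
have j_lt : j < a by nia.
have : a %| (a - 1 - j) * b by rewrite mulnBl eab addnK dvdn_mull.
by rewrite Gauss_dvdl // => /dvdn_leq; nia.
Qed.

Section Factor.
Variable A : eqType.
Implicit Types u v w : seq A.

Definition factor i k w := take k (drop i w).

Lemma size_factor i k w : i + k <= size w -> size (factor i k w) = k.
Proof. by move=> ikw; rewrite size_takel // size_drop; lia. Qed.

Lemma cat_factor i k w : take i w ++ factor i k w ++ drop (k + i) w = w.
Proof. by rewrite -drop_drop !cat_take_drop. Qed.

Lemma factor_cat u v w : factor (size u) (size v) (u ++ v ++ w) = v.
Proof. by rewrite /factor drop_size_cat // take_size_cat. Qed.

Lemma factor_catr i k u v : factor (i + size u) k (u ++ v) = factor i k v.
Proof. by rewrite /factor -drop_drop drop_size_cat. Qed.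

Lemma factor_prefix i k u w :
  prefix u w -> i + k <= size u -> factor i k w = factor i k u.
Proof.
move=> /prefixP[v ->] iku; rewrite /factor drop_cat; case: ltnP => iu.
  by rewrite takel_cat // size_drop; lia.
have -> : k = 0 by lia.
by rewrite !take0.
Qed.

Lemma factor_factor i j k k' w :
  j + k' <= k -> factor j k' (factor i k w) = factor (i + j) k' w.
Proof.
move=> jk'k; rewrite /factor (addnC i) -drop_drop take_drop.
by rewrite take_takel; [rewrite -take_drop | rewrite addnC].
Qed.

End Factor.

Section KleeneStar.
Variable A : eqType.
Implicit Types (L : set (seq A)) (u v w : seq A).

Lemma kleene_star_nil L : kleene_star L [::].
Proof. by exists [::]. Qed.

Lemma sub_kleene_star L : L `<=` kleene_star L.
Proof.
move=> u Lu; exists [:: u]; last by rewrite /= cats0.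
by move=> v; rewrite inE => /eqP->.
Qed.

Lemma kleene_star_cat L u v :
  kleene_star L u -> kleene_star L v -> kleene_star L (u ++ v).
Proof.
move=> [us Lus ->] [vs Lvs ->]; exists (us ++ vs); last by rewrite flatten_cat.
by move=> x; rewrite mem_cat => /orP[/Lus|/Lvs].
Qed.

Lemma kleene_star_size_mul L a c w :
  words_of_length a `<=` kleene_star L -> size w = c * a -> kleene_star L w.
Proof.
move=> aL; elim: c w => [|c IH] w sw.
  by rewrite (size0nil sw); exact: kleene_star_nil.
rewrite -(cat_take_drop a w); apply: kleene_star_cat.
  by apply: aL; rewrite /words_of_length /= size_takel // sw mulSn leq_addr.
by apply: IH; rewrite size_drop sw mulSn addKn.
Qed.

Lemma kleene_star_nat_span L a b w :
  words_of_length a `<=` kleene_star L ->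
  words_of_length b `<=` kleene_star L ->
  nat_span a b (size w) -> kleene_star L w.
Proof.
move=> aL bL [i [j sw]]; rewrite -(cat_take_drop (i * a) w).
apply: kleene_star_cat.
  apply: (kleene_star_size_mul aL (c := i)).
  by rewrite size_takel // sw leq_addr.
by apply: (kleene_star_size_mul bL (c := j)); rewrite size_drop sw addKn.
Qed.

End KleeneStar.

Lemma cofinite_language_size_le (A : finType) (L : set (seq A)) N :
  (forall w, (~` L) w -> size w <= N) -> cofinite_language L.
Proof.
move=> sizeL.
apply: (@sub_finite_set _ _ (\bigcup_(i in `I_N.+1) range (@tval i A))).
  move=> w /sizeL w_le; exists (size w); first by rewrite /= ltnS.
  by exists (in_tuple w).
apply: bigcup_finite => [|i _]; first exact: finite_II.
exact/finite_image/finite_finset.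
Qed.

Section TwoLengths.
Variables (A : eqType) (L : set (seq A)) (m n q : nat).
Implicit Types u v w : seq A.
Local Notation l := (q * m + n).

Lemma kleene_star_factor w j : words_of_length m `<=` L -> size w = l ->
  j <= q -> L (factor (j * m) n w) -> kleene_star L w.
Proof.
move=> mL sw jq Lf.
have mL' := subset_trans mL (@sub_kleene_star A L).
have jm_le : j * m <= q * m by rewrite leq_mul2r jq orbT.
rewrite -(cat_factor (j * m) n w); apply: kleene_star_cat.
  by apply: (kleene_star_size_mul mL' (c := j)); rewrite size_takel; lia.
apply: kleene_star_cat; first exact: sub_kleene_star.
apply: (kleene_star_size_mul mL' (c := q - j)).
by rewrite size_drop mulnBl; lia.
Qed.

Hypothesis sizeL : L `<=` words_of_length m `|` words_of_length n.

Lemma nat_span_size_prefix u w :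
  (forall p j, p < q -> p * m + j * l + n <= size w ->
     ~ L (factor (p * m + j * l) n w)) ->
  kleene_star L u -> prefix u w -> nat_span m l (size u).
Proof.
move=> notLw [us + ->].
elim/last_ind: us => [|us v IH] Lus; first by exists 0, 0.
rewrite flatten_rcons => uvw.
have [u' u'us|i [j size_us]] := IH _ (catl_prefix uvw).
  by apply: Lus; rewrite mem_rcons inE u'us orbT.
have Lv : L v by apply: Lus; rewrite mem_rcons mem_head.
rewrite size_cat size_us; case: (sizeL Lv) => size_v; rewrite size_v.
  by exists i.+1, j; lia.
have [iq|qi] := ltnP i q; last by exists (i - q), j.+1; nia.
case: (notLw i j iq); rewrite -size_us -size_v.
  by rewrite -size_cat size_prefix.
by case/prefixP: uvw => x ->; rewrite -catA factor_cat.
Qed.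

End TwoLengths.

Section PeriodicWord.
Variable A : eqType.
Implicit Types P : seq A.

Lemma size_flatten_nseq k P : size (flatten (nseq k P)) = k * size P.
Proof. by rewrite size_flatten /shape map_nseq sumn_nseq mulnC. Qed.

Definition periodic_word N P := take N (flatten (nseq N P)).

Lemma size_periodic_word N P : 0 < size P -> size (periodic_word N P) = N.
Proof.
by move=> P_gt0; rewrite size_takel // size_flatten_nseq leq_pmulr.
Qed.

Lemma factor_periodic_word N P j i k : 0 < k -> i + k <= size P ->
  i + j * size P + k <= N ->
  factor (i + j * size P) k (periodic_word N P) = factor i k P.
Proof.
move=> k_gt0 ikP ijkN.
have P_gt0 : 0 < size P by lia.
rewrite -(factor_prefix (prefix_take _ N)) -/(periodic_word _ _); last first.
  by rewrite size_periodic_word.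
have jN : j < N by nia.
rewrite -(subnKC (ltnW jN)) nseqD flatten_cat.
rewrite -size_flatten_nseq factor_catr; apply: factor_prefix => //.
by rewrite -(subnSK jN) prefix_prefix.
Qed.

End PeriodicWord.

Section Intercalate.
Variables (A : eqType) (x : nat -> seq A) (z : seq A) (d : nat).
Hypothesis size_x : forall i, size (x i) = d.

Definition intercalate q := flatten (mkseq (fun i => x i ++ z) q) ++ x q.

Lemma intercalateS q : intercalate q.+1 = intercalate q ++ z ++ x q.+1.
Proof. by rewrite /intercalate mkseqS flatten_rcons -!catA. Qed.

Lemma size_intercalate q : size (intercalate q) = q * (d + size z) + d.
Proof.
elim: q => [|q IH]; first by rewrite /= size_x.
by rewrite intercalateS size_cat IH size_cat size_x; lia.
Qed.

Lemma factor_intercalate q p : p < q ->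
  factor (p * (d + size z)) (d + size z + d) (intercalate q) =
  x p ++ z ++ x p.+1.
Proof.
elim: q => // q IH; rewrite ltnS leq_eqVlt intercalateS => /predU1P[->|pq].
  have := size_intercalate q; rewrite /intercalate -catA.
  move: (flatten _) => u; rewrite size_cat size_x => /addIn size_u.
  have := factor_cat u (x q ++ z ++ x q.+1) [::].
  by rewrite cats0 size_u !size_cat !size_x addnA.
rewrite -IH //; apply: factor_prefix; first exact: prefix_prefix.
by rewrite size_intercalate; nia.
Qed.

End Intercalate.

Lemma size_base_rep N k L : size (base_rep N k L) = L.
Proof. by elim: L N => //= L IH N; rewrite size_rcons IH. Qed.

Lemma all_gtn_base_rep N k L : 0 < k -> all (gtn k) (base_rep N k L).
Proof.
move=> k_gt0; elim: L N => //= L IH N.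
by rewrite all_rcons IH andbT /= ltn_mod.
Qed.

Lemma base_rep_inj k L M N :
  M < k ^ L -> N < k ^ L -> base_rep M k L = base_rep N k L -> M = N.
Proof.
elim: L M N => [|L IH] M N; first by rewrite expn0; lia.
rewrite expnSr => M_lt N_lt /= /rcons_inj[eq_div eq_mod].
have k_gt0 : 0 < k by case: (k) M_lt => //; rewrite muln0.
rewrite (divn_eq M k) (divn_eq N k) eq_mod; congr (_ * _ + _).
by apply: IH => //; rewrite ltn_divLR.
Qed.

Section BaseWord.
Variables s k : nat.
Implicit Types M N : nat.

Definition base_word N : seq 'I_s := pmap insub (base_rep N s k).

Hypothesis s_gt0 : 0 < s.

Lemma val_base_word N : map val (base_word N) = base_rep N s k.
Proof.
rewrite (pmap_filter (insubK _)); apply/all_filterP.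
by rewrite (eq_all (isSome_insub _)) all_gtn_base_rep.
Qed.

Lemma size_base_word N : size (base_word N) = k.
Proof. by rewrite -(size_map val) val_base_word size_base_rep. Qed.

Lemma base_word_inj M N :
  M < s ^ k -> N < s ^ k -> base_word M = base_word N -> M = N.
Proof.
move=> M_lt N_lt /(congr1 (map val)); rewrite !val_base_word.
exact: base_rep_inj.
Qed.

End BaseWord.

Section SLang.
Variables s m n : nat.
Hypotheses (s_gt1 : 1 < s) (lt_mn : m < n) (lt_n2m : n < 2 * m).
Implicit Type w : seq 'I_s.
Local Notation d := (n - m).
Local Notation q := (s ^ d - 1).
Local Notation l := (q * m + n).

Let s_gt0 : 0 < s := ltnW s_gt1.

Let q_gt0 : 0 < q.
Proof. by rewrite subn_gt0 -(expn0 s) ltn_exp2l // subn_gt0. Qed.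

Definition zero_word : seq 'I_s := nseq (2 * m - n) (Ordinal s_gt0).

Definition T_word i := base_word s d i ++ zero_word ++ base_word s d i.+1.

Lemma size_T_word i : size (T_word i) = n.
Proof. by rewrite !size_cat !size_base_word // size_nseq; lia. Qed.

Lemma T_wordP w : T m n w <-> exists2 i, i < q & w = T_word i.
Proof.
have val_T_word i : map val (T_word i) =
    base_rep i s d ++ nseq (2 * m - n) 0 ++ base_rep i.+1 s d.
  by rewrite !map_cat !val_base_word // map_nseq.
split=> -[i i_lt ew]; exists i; try lia.
  by apply: (inj_map val_inj); rewrite ew val_T_word.
by rewrite ew val_T_word.
Qed.

Lemma S_lang_sub_words_of_length :
  @S_lang s m n `<=` words_of_length m `|` words_of_length n.
Proof. by move=> w []. Qed.

Lemma words_of_length_sub_S_lang : words_of_length m `<=` @S_lang s m n.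
Proof.
move=> w sw; split; first by left.
case/T_wordP=> i _ ew; move: sw.
by rewrite /words_of_length /= ew size_T_word; lia.
Qed.

Lemma T_word_prefix i : factor 0 d (T_word i) = base_word s d i.
Proof. by rewrite /factor drop0 take_size_cat ?size_base_word. Qed.

Lemma T_word_suffix i : factor m d (T_word i) = base_word s d i.+1.
Proof.
rewrite /factor /T_word catA drop_size_cat.
  by rewrite take_oversize ?size_base_word.
by rewrite size_cat size_base_word // size_nseq; lia.
Qed.

Lemma T_word_consecutive w a i i' : i < q -> i' < q ->
  factor a n w = T_word i -> factor (a + m) n w = T_word i' -> i' = i.+1.
Proof.
move=> iq i'q ei ei'; apply: (@base_word_inj s d); try lia.
transitivity (factor (a + m) d w).
  by rewrite -T_word_prefix -ei' factor_factor ?leq_subr // addn0.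
by rewrite -T_word_suffix -ei factor_factor // subnKC // ltnW.
Qed.

Lemma words_of_length_sub_kleene_star_S_lang :
  words_of_length l `<=` kleene_star (@S_lang s m n).
Proof.
move=> w sw; apply: contrapT => Sw.
have Tw j : j <= q -> exists2 i, i < q & factor (j * m) n w = T_word i.
  move=> jq; apply/T_wordP; apply: contrapT => NTw; apply: Sw.
  apply: (kleene_star_factor words_of_length_sub_S_lang sw jq).
  split=> //; right.
  by rewrite /words_of_length /= size_factor // sw leq_add2r leq_mul2r jq orbT.
have ge_index j : j <= q ->
    exists i, [/\ j <= i, i < q & factor (j * m) n w = T_word i].
  elim: j => [|j IH] jq; first by have [i] := Tw 0 jq; exists i.
  have [i [ji iq ei]] := IH (ltnW jq).
  have [i' i'q ei'] := Tw _ jq; exists i'; split=> //.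
  rewrite mulSn addnC in ei'.
  by rewrite (T_word_consecutive iq i'q ei ei').
by have [i [qi iq _]] := ge_index q (leqnn q); lia.
Qed.

(* The padding brings the length from [q m + (n - m)] to [l]. *)
Definition T_period :=
  intercalate (base_word s d) zero_word q ++ nseq m (Ordinal s_gt0).

Lemma size_T_period : size T_period = l.
Proof.
rewrite size_cat (size_intercalate _ (size_base_word d s_gt0)) !size_nseq.
by nia.
Qed.

Lemma factor_T_period p : p < q -> factor (p * m) n T_period = T_word p.
Proof.
move=> pq; have size_block : d + size zero_word = m by rewrite size_nseq; lia.
have size_reps := size_intercalate zero_word (size_base_word d s_gt0) q.
have := factor_intercalate zero_word (size_base_word d s_gt0) pq.
rewrite /T_word size_block subnKC ?(ltnW lt_mn) // => <-.
by apply: factor_prefix; rewrite ?prefix_prefix // size_reps size_block; nia.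
Qed.

Lemma T_periodic_word N p j : p < q -> p * m + j * l + n <= N ->
  T m n (factor (p * m + j * l) n (periodic_word N T_period)).
Proof.
move=> pq pjN; apply/T_wordP; exists p => //.
rewrite -factor_T_period // -size_T_period.
rewrite factor_periodic_word ?size_T_period //; first by lia.
by rewrite leq_add2r leq_mul2r ltnW // orbT.
Qed.

Lemma nat_span_size_periodic_word N :
  kleene_star (@S_lang s m n) (periodic_word N T_period) -> nat_span m l N.
Proof.
have sizeN : size (periodic_word N T_period) = N.
  by rewrite size_periodic_word // size_T_period; lia.
rewrite -{2}sizeN => Sw.
apply: (nat_span_size_prefix S_lang_sub_words_of_length _ Sw (prefix_refl _)).
by move=> p j pq; rewrite sizeN => /(T_periodic_word pq) Tw [].
Qed.

End SLang.

Unset Implicit Arguments.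

Theorem theorem23 (s m n : nat) (hs : 2 <= s) (hm : 0 < m) (hmn : m < n)
    (hn2m : n < 2 * m) (hgcd : gcdn m n = 1) :
  let S : set (seq 'I_s) := S_lang m n in
  let l := m * s ^ (n - m) + n - m in
  cofinite_language (kleene_star S) /\
  (exists2 w : seq 'I_s, (~` kleene_star S) w & size w = g m l) /\
  (forall w : seq 'I_s, (~` kleene_star S) w -> size w <= g m l).
Proof.
move=> S l.
have el : l = (s ^ (n - m) - 1) * m + n.
  have : 0 < s ^ (n - m) by rewrite expn_gt0; lia.
  by rewrite /l; nia.
have co_ml : coprime m l by rewrite el /coprime gcdnMDl hgcd.
have size_le w : (~` kleene_star S) w -> size w <= g m l.
  move=> Sw; rewrite leqNgt; apply/negP => /(gt_Frobenius_nat_span hm co_ml).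
  rewrite el => sw; apply: Sw; apply: kleene_star_nat_span sw.
    apply: subset_trans (@sub_kleene_star _ _).
    exact: words_of_length_sub_S_lang.
  exact: words_of_length_sub_kleene_star_S_lang.
split; first exact: cofinite_language_size_le size_le.
split=> //; exists (periodic_word (g m l) (T_period m n hs)).
  move=> /(nat_span_size_periodic_word hmn hn2m); rewrite -el.
  by apply: Frobenius_notin_nat_span => //; lia.
by rewrite size_periodic_word // size_T_period; lia.
Qed.
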